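(* Let $N\in\mathbb{N}$, $s\in(0,1)$ with $N>2s$. Let $\mathcal{G}_{s,\infty}$ and $\mathcal{P}_{s,\infty}$ be the Green kernel and the Poisson kernel of $(-\Delta)^s$ in $\mathbb{R}^N_+$ given by $$\mathcal{G}_{s,\infty}(x,y)=\begin{cases}\frac{\kappa_{N,s}}{2}|x-y|^{2s-N}\int_0^{\frac{4x_1y_1}{|x-y|^2}}t^{s-1}(t+1)^{-\frac N2}dt, & x,y\in\mathbb{R}^N_+,\\ 0, & x\notin\mathbb{R}^N_+\text{ or }y\notin\mathbb{R}^N_+,\end{cases}$$ $$\mathcal{P}_{s,\infty}(x,y)=\mathcal{K}_s\Big(\frac{x_1}{-y_1}\Big)^s|x-y|^{-N},\quad x\in\mathbb{R}^N_+,\ y\in\mathbb{R}^N_-.$$ Let $\mathcal{P}_s(x)=\mathcal{K}_s|x|^{-N}x_1^s$ for $x\in\mathbb{R}^N_+$. Then, as $\epsilon\to0^+$, $$\epsilon^{-s}\mathcal{G}_{s,\infty}(\cdot,\epsilon e_1)\to\mathcal{P}_s\qquad\text{and}\qquad \epsilon^{s}\mathcal{P}_{s,\infty}(\cdot,-\epsilon e_1)\to\mathcal{P}_s,$$ both in $L^1_s(\mathbb{R}^N_+)$ and uniformly on every compact subset of $\mathbb{R}^N_+$.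
   Context: Write $x=(x_1,x')$, $\mathbb{R}^N_+=(0,\infty)\times\mathbb{R}^{N-1}$, $\mathbb{R}^N_-=(-\infty,0)\times\mathbb{R}^{N-1}$, $e_1=(1,0,\dots,0)$. Constants: $\kappa_{N,s}=\pi^{-(N/2+1)}\Gamma(N/2)\sin(\pi s)$ and $\mathcal{K}_s=\kappa_{N,s}2^{2s-1}s^{-1}$. Convergence $f_\epsilon\to f$ in $L^1_s(\mathbb{R}^N_+)$ means $\int_{\mathbb{R}^N_+}\frac{|f_\epsilon(x)-f(x)|}{1+|x|^{N+2s}}dx\to0$. *)

(* Defs.v *)
From HB Require Import structures.
From mathcomp Require Import all_boot all_order all_algebra.
From mathcomp Require Import all_classical all_reals all_analysis.
Import Order.TTheory GRing.Theory Num.Theory.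
Import numFieldNormedType.Exports.
Local Open Scope classical_set_scope.
Local Open Scope ring_scope.

Section Defs.
Variable R : realType.
Local Notation leb := (@lebesgue_measure R).

Definition Gamma (z : R) : R :=
  Rintegral leb `]0, +oo[ (fun t => t `^ (z - 1) * expR (- t)).

Definition kappa (N : nat) (s : R) : R :=
  pi `^ (- (N%:R / 2 + 1)) * Gamma (N%:R / 2) * sin (pi * s).

Definition Kcst (N : nat) (s : R) : R :=
  kappa N s * 2 `^ (2 * s - 1) / s.

Definition coord1 (N : nat) (x : 'rV[R]_N.+1) : R := x ord0 ord0.

Definition enorm (N : nat) (x : 'rV[R]_N) : R :=
  Num.sqrt (\sum_(i < N) x ord0 i ^+ 2).

Definition e1 (N : nat) : 'rV[R]_N.+1 := \row_(i < N.+1) (i == ord0)%:R.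

Definition upper_half (N : nat) : set 'rV[R]_N.+1 := [set x | 0 < coord1 N x].
Definition lower_half (N : nat) : set 'rV[R]_N.+1 := [set x | coord1 N x < 0].

(* Green kernel G_{s,∞} of (-Δ)^s in R^N_+ (space dimension N.+1 here) *)
Definition green (N : nat) (s : R) (x y : 'rV[R]_N.+1) : R :=
  if (0 < coord1 N x) && (0 < coord1 N y) then
    kappa N.+1 s / 2 * enorm N.+1 (x - y) `^ (2 * s - N.+1%:R) *
    Rintegral leb `[0, 4 * coord1 N x * coord1 N y / enorm N.+1 (x - y) ^+ 2]
      (fun t => t `^ (s - 1) * (t + 1) `^ (- (N.+1%:R / 2)))
  else 0.

Definition poisson (N : nat) (s : R) (x y : 'rV[R]_N.+1) : R :=
  Kcst N.+1 s * (coord1 N x / - coord1 N y) `^ s * enorm N.+1 (x - y) `^ (- N.+1%:R).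

Definition Ps (N : nat) (s : R) (x : 'rV[R]_N.+1) : R :=
  Kcst N.+1 s * enorm N.+1 x `^ (- N.+1%:R) * coord1 N x `^ s.

(* Iterated Lebesgue integral over R^n of a function of n real coordinates
   (coordinates n-1, ..., 0, outermost first).  For nonnegative integrands
   this is the Lebesgue integral over R^n (Tonelli). *)
Fixpoint iter_int (n : nat) (g : (nat -> R) -> \bar R) : \bar R :=
  match n with
  | 0 => g (fun _ => 0)
  | k.+1 => (\int[leb]_(t in setT)
               iter_int k (fun y => g (fun i => if i == k then t else y i)))%E
  end.

Definition vec_of (n : nat) (y : nat -> R) : 'rV[R]_n := \row_(i < n) y i.

Definition L1s_dist (N : nat) (s : R) (f g : 'rV[R]_N.+1 -> R) : \bar R :=
  iter_int N.+1 (fun y =>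
    let x := vec_of N.+1 y in
    if 0 < coord1 N x then
      (`|f x - g x| / (1 + enorm N.+1 x `^ (N.+1%:R + 2 * s)))%:E
    else 0%E).

Definition cvg_L1s (N : nat) (s : R) (f : R -> 'rV[R]_N.+1 -> R)
    (g : 'rV[R]_N.+1 -> R) : Prop :=
  (fun eps => L1s_dist N s (f eps) g) @ 0^'+ --> 0%E.

Definition cvg_unif_compact (N : nat) (f : R -> 'rV[R]_N.+1 -> R)
    (g : 'rV[R]_N.+1 -> R) : Prop :=
  forall K : set 'rV[R]_N.+1, compact K -> K `<=` upper_half N ->
  forall e : R, 0 < e ->
    \forall eps \near 0^'+, forall x, K x -> `|f eps x - g x| < e.

End Defs.

(* Main.v *)
(** Put r = |x|, rho = |x - eps e_1|, rho' = |x + eps e_1| and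
    X = 4 x_1 eps / rho^2, so that rho^2 (1 + X) = rho'^2.  Bounding the factor
    (t + 1)^(-N/2) of the Green integral by 1 from above and by (1 + X)^(-N/2)
    from below, both integrals become explicit and the Green kernel is squeezed:
      K x_1^s rho'^(-N) <= eps^(-s) G(x, eps e_1) <= K x_1^s rho^(-N).
    For rho < eps / 2 the upper bound is replaced by the one coming from
    (t + 1)^(-N/2) <= t^(-s/4).  As |rho - r| <= eps and |rho' - r| <= eps, both
    rescaled kernels differ from P_s by at most
      C eps^(s/2) (r^(-a) + rho^(-a)),   a = N - s / 2 < N.
    On a compact subset of the half space r and rho are bounded below, which
    gives uniform convergence.  For the L^1_s convergence,
    r^(-a) <= prod_i |x_i|^(-a/N) and likewise for rho and for the weight, so
    the integrand is dominated by eps^(s/2) times a product of integrable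
    functions of one variable. *)

Require Import Defs.
From HB Require Import structures.
From mathcomp Require Import all_boot all_order all_algebra.
From mathcomp Require Import all_classical all_reals all_analysis.
From mathcomp Require Import measurable_realfun ring lra.
Import Order.TTheory GRing.Theory Num.Theory.
Import numFieldNormedType.Exports.
Local Open Scope classical_set_scope.
Local Open Scope ring_scope.

(** * Lebesgue integrals on the line *)

(* [f] need not be measurable: the integral of a nonnegative function is the
   supremum of the integrals of the simple functions below it. *)
Lemma le_integral_negligible d (T : measurableType d) (R : realType)
    (mu : {measure set T -> \bar R}) (Z : set T) (f g : T -> \bar R) :
  measurable Z -> mu Z = 0%E -> measurable_fun setT g ->
  (forall x, 0 <= f x)%E -> (forall x, 0 <= g x)%E ->
  (forall x, ~ Z x -> f x <= g x)%E ->
  (\int[mu]_x f x <= \int[mu]_x g x)%E.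
Proof.
move=> mZ Z0 mg f0 g0 fg.
(* [h] is raised to [+oo] on [Z], so that [f <= h] everywhere while [h] and [g] have the same
   integral. *)
pose h x := if x \in Z then +oo%E else g x.
have mh : measurable_fun setT h.
  apply: measurable_fun_ifT => //.
  apply: (@measurable_fun_bool _ _ _ _ true); rewrite setTI.
  rewrite [X in measurable X](_ : _ = Z)//.
  by apply/seteqP; split => x /= => [/set_mem|/mem_set].
have h0 x : (0 <= h x)%E by rewrite /h; case: ifP.
have -> : (\int[mu]_x g x = \int[mu]_x h x)%E.
  apply: ge0_ae_eq_integral => //.
  exists Z; split => // x /= gh; apply: contrapT => nZ; apply: gh => _.
  by rewrite /h memNset.
have fh x : (f x <= h x)%E.
  rewrite /h; case: ifPn => [_|]; first exact: leey.
  by rewrite notin_setE; exact: fg.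
rewrite !ge0_integralTE//; apply: le_ereal_sup => _ [k /= kf <-].
by exists k => // x; exact: le_trans (kf x) (fh x).
Qed.

(** Lebesgue measure is determined by its values on half-open intervals, and a translation preserves
    their lengths. *)
Lemma lebesgue_measure_shift (R : realType) (c : R) (A : set R) :
  measurable A ->
  pushforward lebesgue_measure ((fun x => x + c) : _ -> measurableTypeR R) A =
  lebesgue_measure A.
Proof.
move=> mA.
have mf : measurable_fun setT ((fun x => x + c) : measurableTypeR R -> measurableTypeR R).
  exact: measurable_funD.
pose m := measure_function_pushforward__canonical__measure_function_Measure lebesgue_measure mf.
apply/esym/(@lebesgue_measure_unique R m) => //= _ [[a b]] _ <-.
rewrite /pushforward (_ : _ @^-1` _ = `]a - c, b - c]%classic); last first.
  by apply/seteqP; split => x /=; rewrite !in_itv/= ltrBlDr lerBrDr.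
rewrite !lebesgue_measure_itv/= !lte_fin ltrD2r.
by case: ifP => // _; rewrite -!EFinB; congr (_%:E); ring.
Qed.

Lemma ge0_integral_shift (R : realType) (c : R) (f : R -> \bar R) :
  measurable_fun setT f -> (forall x, 0 <= f x)%E ->
  (\int[lebesgue_measure]_x f (x + c)%R = \int[lebesgue_measure]_x f x)%E.
Proof.
move=> mf f0.
have mh : measurable_fun setT ((fun x => x + c) : measurableTypeR R -> measurableTypeR R).
  exact: measurable_funD.
have := @ge0_integral_pushforward _ _ _ _ R _ mh lebesgue_measure setT f measurableT mf.
rewrite preimage_setT => <-; last by move=> x _; exact: f0.
by apply: eq_measure_integral => A mA _; exact: lebesgue_measure_shift.
Qed.

Lemma ge0_integral_oppr (R : realType) (f : R -> \bar R) :
  measurable_fun setT f -> (forall x, 0 <= f x)%E ->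
  (\int[lebesgue_measure]_x f (- x)%R = \int[lebesgue_measure]_x f x)%E.
Proof.
move=> mf f0.
have mh : measurable_fun setT (-%R : measurableTypeR R -> measurableTypeR R).
  exact: measurable_funN.
have := @ge0_integral_pushforward _ _ _ _ R _ mh lebesgue_measure setT f measurableT mf.
rewrite preimage_setT => <-; last by move=> x _; exact: f0.
by apply: eq_measure_integral => A mA _; exact: lebesgue_measureN.
Qed.

(** * Integrals of powers on segments, near 0 and at infinity *)

Section power_integrals.
Context {R : realType}.
Local Notation mu := (@lebesgue_measure R).

Lemma measurable_powR_EFin (D : set R) (p : R) :
  measurable_fun D (fun x : R => (x `^ p)%:E).
Proof.
by apply/measurable_EFinP/measurable_funTS; exact: measurable_powR.
Qed.

Lemma integral_powR_segment (p a b : R) : p != 0 -> 0 < a -> a < b ->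
  (\int[mu]_(x in `[a, b]) (x `^ (p - 1))%:E = (b `^ p / p - a `^ p / p)%:E)%E.
Proof.
move=> p0 a0 ab.
have dF (x : R) : 0 < x -> is_derive x 1 (fun t : R => t `^ p / p) (x `^ (p - 1)).
  move=> x0.
  have := is_deriveZ p^-1 (is_derive1_powR p x0).
  rewrite [_ *: _]mulrA mulVf// mul1r.
  by congr is_derive; apply/funext => t; rewrite /= [LHS]mulrC.
have cont (x : R) : 0 < x -> {for x, continuous (fun t : R => t `^ p / p)}.
  move=> x0; apply/differentiable_continuous/derivable1_diffP.
  by apply: ex_derive; exact: dF.
have cont' (x : R) : 0 < x -> {for x, continuous (fun t : R => t `^ (p - 1))}.
  move=> x0; apply/differentiable_continuous/derivable1_diffP.
  by apply: derivable_powR; rewrite in_itv/= x0.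
rewrite (@continuous_FTC2 _ _ (fun t => t `^ p / p))//.
- apply: continuous_in_subspaceT => x; rewrite inE/= in_itv/= => /andP[ax _].
  exact/cont'/(lt_le_trans a0).
- split.
  + move=> x; rewrite in_itv/= => /andP[ax _].
    by apply: ex_derive; exact/dF/(lt_trans a0).
  + exact/cvg_at_right_filter/cont.
  + exact/cvg_at_left_filter/cont/(lt_trans a0).
- move=> x; rewrite in_itv/= => /andP[ax _].
  by rewrite derive1E; apply: derive_val; exact/dF/(lt_trans a0).
Qed.

(** Monotone convergence over segments that exhaust []0, X]]; the lower end contributes nothing in
    the limit because [p > 0]. *)
Lemma integral_powR_0c (p X : R) : 0 < p -> 0 < X ->
  (\int[mu]_(x in `]0%R, X]) (x `^ (p - 1))%:E = (X `^ p / p)%:E)%E.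
Proof.
move=> p0 X0.
(* The shift by two keeps [a 0] strictly below [X]. *)
pose a n : R := X * n.+2%:R^-1.
have a0 n : 0 < a n by rewrite mulr_gt0// invr_gt0.
have aX n : a n < X by rewrite gtr_pMr// invf_lt1// ltr1n.
have acvg : a @ \oo --> (0 : R).
  rewrite -(mulr0 X); apply: cvgMr.
  have := @cvg_harmonic R.
  by rewrite -(@cvg_shiftS R (@harmonic R)); apply.
have -> : `]0, X]%classic = \bigcup_n `[a n, X]%classic.
  apply/seteqP; split => [x|x [n _]] /=; rewrite !in_itv/=; last first.
    by move=> /andP[ax ->]; rewrite andbT (lt_le_trans (a0 n)).
  move=> /andP[x0 xX].
  have /cvgrPdist_lt/(_ _ x0) [N _ HN] := acvg.
  exists N => //=; rewrite in_itv/= xX andbT ltW//.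
  by have := HN N (leqnn N); rewrite sub0r normrN gtr0_norm.
have H : (\int[mu]_(x in `[a n, X]) (x `^ (p - 1))%:E)%E @[n --> \oo] -->
  (\int[mu]_(x in \bigcup_n `[a n, X]%classic) (x `^ (p - 1))%:E)%E.
  apply: ge0_nondecreasing_set_cvg_integral => //.
  - apply/nondecreasing_seqP => n; rewrite subsetEset => x /=; rewrite !in_itv/=.
    move=> /andP[ax ->]; rewrite andbT (le_trans _ ax)//.
    by rewrite ler_wpM2l ?ltW// ltf_pV2 ?posrE// ltr_nat.
  - by move=> n; exact: measurable_powR_EFin.
  - by move=> n x _; rewrite lee_fin powR_ge0.
have H2 : (\int[mu]_(x in `[a n, X]) (x `^ (p - 1))%:E)%E @[n --> \oo] -->
    (X `^ p / p)%:E.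
  rewrite (eq_cvg _ _ (fun n =>
    integral_powR_segment _ _ _ (lt0r_neq0 p0) (a0 n) (aX n))).
  apply: cvg_EFin; first by near=> n.
  rewrite -[X in _ --> X]subr0 -(mul0r p^-1).
  apply: cvgB; first exact: cvg_cst.
  apply: cvgMl.
  by have /cvg_at_rightP := powR_cvg0 p0; apply.
exact: (cvg_unique _ H H2).
Unshelve. all: by end_near. Qed.

Lemma integral_powR_tail (b : R) : 1 < b ->
  (\int[mu]_(x in `[1%R, +oo[) (x `^ (- b))%:E <= ((b - 1)^-1)%:E)%E.
Proof.
move=> b1.
pose a n : R := n.+2%:R.
have -> : `[1%R, +oo[%classic = \bigcup_n `[1%R, a n]%classic.
  apply/seteqP; split => [x|x [n _]] /=; rewrite !in_itv/=; last first.
    by move=> /andP[-> _].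
  rewrite andbT => x1; exists (Num.truncn x) => //=.
  rewrite in_itv/= x1/= ltW// (lt_trans (truncnS_gt _))// ltr_nat//.
have H : (\int[mu]_(x in `[1%R, a n]) (x `^ (- b))%:E)%E @[n --> \oo] -->
  (\int[mu]_(x in \bigcup_n `[1%R, a n]%classic) (x `^ (- b))%:E)%E.
  apply: ge0_nondecreasing_set_cvg_integral => //.
  - apply/nondecreasing_seqP => n; rewrite subsetEset => x /=; rewrite !in_itv/=.
    by move=> /andP[->]/= /le_trans; apply; rewrite ler_nat.
  - by move=> n; exact: measurable_powR_EFin.
  - by move=> n x _; rewrite lee_fin powR_ge0.
rewrite -(cvg_lim _ H)//; apply: lime_le; first by apply/cvg_ex; eexists; exact: H.
near=> n.
(* The antiderivative has the negative exponent [1 - b], so the segment integral falls short of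
   [1 / (b - 1)] by a nonnegative term. *)
have -> : - b = (1 - b) - 1 by ring.
rewrite integral_powR_segment//; last 2 first.
  by rewrite subr_eq0 lt_eqF.
  by rewrite ltr1n.
rewrite lee_fin powR1 -(opprB b 1) invrN mulrN mulrN opprK mul1r gerDr.
by rewrite oppr_le0 divr_ge0 ?powR_ge0// subr_ge0 ltW.
Unshelve. all: by end_near. Qed.

End power_integrals.

(** * A one-dimensional bound uniform in the position of the singularity *)

Section singular_integral.
Context {R : realType}.
Local Notation mu := (@lebesgue_measure R).

Lemma ge0_integral_symD (f : R -> \bar R) :
  measurable_fun setT f -> (forall x, 0 <= f x)%E ->
  (\int[mu]_x (f x + f (- x)%R) = \int[mu]_x f x + \int[mu]_x f x)%E.
Proof.
move=> mf f0; rewrite ge0_integralD//; first by rewrite ge0_integral_oppr.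
by apply: measurableT_comp => //; exact: measurable_funN.
Qed.

(** Within distance 1 of [c] the weight is at most 1 and the singularity is integrable as [al < 1];
    farther away the singular factor is at most 1 and the weight is integrable as [b > 1].
    Uniformity in [c] matters because [c] will be 0 or eps. *)
Lemma integral_singular_le (al b : R) : 0 < al < 1 -> 1 < b ->
  exists2 C : R, 0 <= C & forall c : R,
  (\int[mu]_t (`|t - c| `^ (- al) * (Num.max 1 `|t|) `^ (- b))%:E <= C%:E)%E.
Proof.
move=> /andP[al0 al1] b1.
pose h : R -> \bar R := (fun t => (t `^ (1 - al - 1))%:E) \_ `]0%R, 1%R].
pose k : R -> \bar R := (fun t => (t `^ (- b))%:E) \_ `[1%R, +oo[.
pose u : R -> \bar R := (cst 1%E) \_ `[(-1)%R, 1%R].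
pose G (t : R) : \bar R := (h t + h (- t)%R)%E; pose K (t : R) : \bar R := (k t + k (- t)%R)%E.
have h0 t : (0 <= h t)%E.
  by apply: erestrict_ge0 => x _; rewrite lee_fin powR_ge0.
have k0 t : (0 <= k t)%E.
  by apply: erestrict_ge0 => x _; rewrite lee_fin powR_ge0.
have u0 t : (0 <= u t)%E by apply: erestrict_ge0 => x _.
have mh : measurable_fun setT h.
  by apply/(measurable_restrictT _ _).1 => //; exact: measurable_powR_EFin.
have mk : measurable_fun setT k.
  by apply/(measurable_restrictT _ _).1 => //; exact: measurable_powR_EFin.
have m_u : measurable_fun setT u.
  by apply/(measurable_restrictT _ _).1.
have mG : measurable_fun setT G.
  by apply: emeasurable_funD => //; apply: measurableT_comp => //; exact: measurable_funN.
have mK : measurable_fun setT K.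
  by apply: emeasurable_funD => //; apply: measurableT_comp => //; exact: measurable_funN.
have G0 t : (0 <= G t)%E by apply: adde_ge0.
have K0 t : (0 <= K t)%E by apply: adde_ge0.
have ih : (\int[mu]_t h t = ((1 - al)^-1)%:E)%E.
  rewrite -integral_mkcond integral_powR_0c ?subr_gt0//.
  by rewrite powR1 mul1r.
have ik : (\int[mu]_t k t <= ((b - 1)^-1)%:E)%E.
  by rewrite -integral_mkcond integral_powR_tail.
have iu : (\int[mu]_t u t = 2%:E)%E.
  rewrite -integral_mkcond integral_cst//= lebesgue_measure_itv/= lte_fin.
  by rewrite ifT ?mul1e -?EFinB ?opprK//; lra.
exists ((1 - al)^-1 + (1 - al)^-1 + (2 + ((b - 1)^-1 + (b - 1)^-1))).
  have ? : 0 <= (1 - al)^-1 by rewrite invr_ge0 subr_ge0 ltW.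
  have ? : 0 <= (b - 1)^-1 by rewrite invr_ge0 subr_ge0 ltW.
  by rewrite !addr_ge0.
move=> c.
have mGc : measurable_fun setT (fun t : R => G (t - c)).
  by apply: measurableT_comp => //; exact: measurable_funB.
apply: (@le_trans _ _ (\int[mu]_t (G (t - c)%R + (u t + K t)))%E); last first.
  rewrite ge0_integralD//; [|by move=> t _; apply: adde_ge0|exact: emeasurable_funD].
  rewrite ge0_integralD// ge0_integral_shift// !ge0_integral_symD// ih iu !EFinD.
  by rewrite leeD2l// leeD2l// leeD.
apply: ge0_le_integral => //.
- apply/measurable_EFinP; apply: measurable_funM.
    apply: (measurableT_comp (measurable_powR _)) => //.
    by apply: measurableT_comp => //; exact: measurable_funB.
  apply: (measurableT_comp (measurable_powR _)) => //.
  apply: measurable_maxr => //.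
- by apply: emeasurable_funD => //; exact: emeasurable_funD.
move=> t _.
have uK : (((Num.max 1 `|t|) `^ (- b))%:E <= u t + K t)%E.
  have [t1|t1] := leP `|t| 1.
    rewrite powR1 -[leLHS]adde0 leeD// /u patchE mem_set//= in_itv/=.
    by rewrite -ler_norml.
  apply: le_trans (leeDr _ (u0 t)).
  have [t0|t0] := leP 0 t.
    rewrite ger0_norm// in t1 *; apply: le_trans (leeDl _ (k0 _)).
    by rewrite /k patchE mem_set//= in_itv/= ltW.
  rewrite ltr0_norm// in t1 *; apply: le_trans (leeDr _ (k0 _)).
  by rewrite /k patchE mem_set//= in_itv/= ltW.
have B1 : (Num.max 1 `|t|) `^ (- b) <= 1.
  have m1 : 1 <= Num.max 1 `|t| by rewrite le_max lexx.
  rewrite -[leRHS](powRr0 (Num.max 1 `|t|)); apply: ler_powR => //.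
  by rewrite oppr_le0 ltW// (lt_trans _ b1).
have B0 : 0 <= (Num.max 1 `|t|) `^ (- b) by exact: powR_ge0.
set x := t - c; set B := _ `^ (- b) in uK B1 B0 *.
have [x1|x1] := leP `|x| 1; last first.
  apply: le_trans (leeDr _ (G0 _)); apply: le_trans uK.
  rewrite lee_fin ler_piMl// -[leRHS](powRr0 `|x|); apply: ler_powR; first exact: ltW.
  by rewrite oppr_le0 ltW.
apply: le_trans (leeDl _ _); last by rewrite adde_ge0.
apply: (@le_trans _ _ (`|x| `^ (- al))%:E).
  by rewrite lee_fin ler_piMr// powR_ge0.
(* At the singularity the power takes the default value 0, so the bound holds although [h] leaves
   out 0. *)
have [->|xn0] := eqVneq x 0.
  by rewrite normr0 powR0// oppr_eq0 gt_eqF.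
have E : - al = 1 - al - 1 by ring.
have [x0|x0] := leP 0 x.
  rewrite ger0_norm// in x1 *; apply: le_trans (leeDl _ (h0 _)).
  by rewrite /h patchE mem_set/= -?E// in_itv/= lt0r xn0 x0.
rewrite ltr0_norm// in x1 *; apply: le_trans (leeDr _ (h0 _)).
by rewrite /h patchE mem_set/= -?E// in_itv/= oppr_gt0 x0.
Qed.
End singular_integral.

(** * Iterated integrals dominated by products *)

Lemma iter_int_ge0 (R : realType) (n : nat) (g : (nat -> R) -> \bar R) :
  (forall y, 0 <= g y)%E -> (0 <= iter_int R n g)%E.
Proof.
elim: n g => [|n IH] g g0 /=; first exact: g0.
by apply: integral_ge0 => t _; apply: IH.
Qed.

(** The induction peels off the outermost coordinate and moves its factor [phi t] into the constant,
    hence [c] varies in it. The null set [Z] is discarded one coordinate at a time. *)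
Lemma iter_int_le_prod (R : realType) (n : nat) (g : (nat -> R) -> \bar R)
    (Z : set R) (phi : R -> R) (C c : R) :
  measurable Z -> lebesgue_measure Z = 0%E ->
  measurable_fun setT phi -> (forall t, 0 <= phi t) ->
  (\int[lebesgue_measure]_t (phi t)%:E <= C%:E)%E ->
  0 <= C -> 0 <= c -> (forall y, 0 <= g y)%E ->
  (forall y, (forall i, (i < n)%N -> ~ Z (y i)) ->
    g y <= (c * \prod_(i < n) phi (y i))%:E)%E ->
  (iter_int R n g <= (c * C ^+ n)%:E)%E.
Proof.
move=> mZ Z0 mphi phi0 phiC C0.
elim: n g c => [|n IH] g c c0 g0 gle /=.
  by rewrite expr0 mulr1; have := gle (fun=> 0); rewrite big_ord0 mulr1; apply.
have cC : 0 <= c * C ^+ n by rewrite mulr_ge0// exprn_ge0.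
apply: (@le_trans _ _
    (\int[lebesgue_measure]_t ((c * C ^+ n)%:E * (phi t)%:E))%E).
  apply: (@le_integral_negligible _ (measurableTypeR R) R lebesgue_measure Z) => //.
  - by apply: emeasurable_funM => //; exact/measurable_EFinP.
  - by move=> t; apply: iter_int_ge0.
  - by move=> t; rewrite -EFinM lee_fin mulr_ge0.
  move=> t nZt; rewrite -EFinM mulrAC; apply: IH => //; first exact: mulr_ge0.
  move=> y nZy; apply: le_trans (gle _ _) _.
    move=> i; rewrite ltnS leq_eqVlt; case: eqVneq => //= _ ilt; exact: nZy.
  rewrite lee_fin big_ord_recr/= eqxx -mulrA [phi t * _]mulrC ler_wpM2l//.
  rewrite le_eqVlt; apply/orP; left; apply/eqP; congr (_ * _).
  by apply: eq_bigr => i _; rewrite ltn_eqF.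
rewrite ge0_integralZl//; first by rewrite exprSr mulrA [leRHS]EFinM lee_wpmul2l.
  exact/measurable_EFinP.
by move=> t _; rewrite lee_fin.
Qed.

(** * Kernel estimates in terms of norms *)

Section power_estimates.
Context {R : realType}.
Implicit Types a b e r x d : R.

Lemma ler_npowR (p a b : R) : 0 <= p -> 0 < a -> a <= b -> b `^ (- p) <= a `^ (- p).
Proof.
move=> p0 a0 ab; rewrite !powRN lef_pV2 ?posrE ?powR_gt0//; last exact: lt_le_trans ab.
by apply: ge0_ler_powR => //; rewrite nnegrE ltW// (lt_le_trans a0).
Qed.

(** Induction on [1 - q^(n+1) = (1 - q) + q (1 - q^n)]. *)
Lemma bernoulli_1subX (n : nat) (q : R) : 0 <= q <= 1 -> 1 - q ^+ n <= n%:R * (1 - q).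
Proof.
move=> /andP[q0 q1]; elim: n => [|n IH]; first by rewrite expr0 subrr mul0r.
have : q * (1 - q ^+ n) <= n%:R * (1 - q).
  apply: le_trans IH; rewrite ler_piMl// subr_ge0 exprn_ile1//.
by rewrite exprS -natr1; lra.
Qed.

(** Pulling out [a^(-n)] leaves [1 - (a / b)^n <= n (1 - a / b)], and
    [1 - a / b <= min(1, e / a) <= (e / a)^d]. The free exponent [d] trades the rate in [e] against
    the singularity in [a]. *)
Lemma powRN_diff (n : nat) (a b e d : R) :
  0 < a -> a <= b -> b <= a + e -> 0 < e -> 0 <= d <= 1 ->
  a `^ (- n%:R) - b `^ (- n%:R) <= n%:R * e `^ d * a `^ (- (n%:R + d)).
Proof.
move=> a0 ab bae e0 /andP[d0 d1].
have b0 : 0 < b := lt_le_trans a0 ab.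
have q01 : 0 <= a / b <= 1 by rewrite ler_pdivrMr// mul1r ab andbT ltW// divr_gt0.
have -> : a `^ (- n%:R) - b `^ (- n%:R) = a `^ (- n%:R) * (1 - (a / b) ^+ n).
  rewrite !powR_invn ?ltW// mulrBr mulr1 expr_div_n mulrA mulVf ?mul1r//.
  by rewrite expf_neq0// gt_eqF.
have -> : n%:R * e `^ d * a `^ (- (n%:R + d)) = a `^ (- n%:R) * (n%:R * (e / a) `^ d).
  rewrite powRM ?invr_ge0 ?ltW// -[in RHS](powR_inv1 (ltW a0)) -powRrM mulN1r.
  rewrite opprD powRD ?(gt_eqF a0) ?implybT//.
  by ring.
rewrite ler_wpM2l ?powR_ge0//.
apply: le_trans (bernoulli_1subX _ _ q01) _; rewrite ler_wpM2l//.
have u0 : 0 < e / a by rewrite divr_gt0.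
have [u1|u1] := leP (e / a) 1.
  apply: (@le_trans _ _ (e / a)); last first.
    by apply: ger1_powR => //; rewrite u0.
  rewrite -subr_ge0.
  have -> : e / a - (1 - a / b) = (e * b - a * b + a * a) / (a * b).
    by field; rewrite !gt_eqF.
  by rewrite divr_ge0//; nra.
apply: (@le_trans _ _ 1); first by rewrite gerBl; case/andP: q01.
by rewrite -(powRr0 (e / a)); apply: ler_powR => //; exact: ltW.
Qed.

(** Here [rp] is |x + e e_1|, and [r <= rp <= r + e]. Taking [d = s / 2] costs [r^(-s/2)], which
    [x^s <= r^s] more than repays: the final singularity stays weaker than [r^(-n)]. *)
Lemma poisson_diff (n : nat) (s e x r rp : R) :
  0 < s < 1 -> 0 < e -> 0 < x <= r -> 0 < rp -> rp ^+ 2 = r ^+ 2 + 2 * e * x + e ^+ 2 ->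
  0 <= x `^ s * r `^ (- n%:R) - x `^ s * rp `^ (- n%:R) <=
  n%:R * e `^ (s / 2) * r `^ (- (n%:R - s / 2)).
Proof.
move=> /andP[s0 s1] e0 /andP[x0 xr] rp0 rpE.
have r0 : 0 < r := lt_le_trans x0 xr.
have ex0 : 0 <= e * x by rewrite mulr_ge0// ltW.
have exr : e * x <= e * r by rewrite ler_wpM2l// ltW.
have e20 : 0 <= e ^+ 2 by exact: sqr_ge0.
have rrp : r <= rp.
  by rewrite -(@ler_pXn2r _ 2) ?nnegrE ?(ltW r0) ?(ltW rp0)// rpE; lra.
have rpr : rp <= r + e.
  by rewrite -(@ler_pXn2r _ 2) ?nnegrE ?(ltW rp0) ?(ltW (addr_gt0 r0 e0))// rpE sqrrD; lra.
rewrite -mulrBr; apply/andP; split.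
  by rewrite mulr_ge0 ?powR_ge0// subr_ge0 ler_npowR.
have := powRN_diff n r rp e (s / 2) r0 rrp rpr e0; set D := _ - _ => H.
apply: (@le_trans _ _ (r `^ s * (n%:R * e `^ (s / 2) * r `^ (- (n%:R + s / 2))))).
  apply: ler_pM; rewrite ?powR_ge0//.
  - by rewrite subr_ge0 ler_npowR.
  - by apply: (ge0_ler_powR (ltW s0)) => //; rewrite nnegrE ltW.
  - by apply: H; lra.
rewrite mulrCA ler_wpM2l ?mulr_ge0 ?powR_ge0// -powRD ?(gt_eqF r0) ?implybT//.
by rewrite le_eqVlt; apply/orP; left; apply/eqP; congr (_ `^ _); lra.
Qed.

End power_estimates.

(** * Bounds for the integral in the Green kernel *)

Section green_integral.
Context {R : realType}.
Local Notation mu := (@lebesgue_measure R).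

Definition green_integral (s nu X : R) : R :=
  Rintegral mu `[0, X] (fun t => t `^ (s - 1) * (t + 1) `^ (- nu)).

Let measurable_integrand (s nu : R) (D : set R) :
  measurable_fun D (fun t : R => (t `^ (s - 1) * (t + 1) `^ (- nu))%:E).
Proof.
apply/measurable_EFinP/measurable_funTS/measurable_funM.
  exact: measurable_powR.
by apply: (measurableT_comp (measurable_powR _)); exact: measurable_funD.
Qed.

(** [(t + 1)^(-nu) <= (t + 1)^(-h) <= t^(-h)] leaves a pure power, integrable at 0 because
    [h < s]. *)
Let integral_integrand_le (s nu X h : R) : 0 < X -> 0 <= h -> h < s -> h <= nu ->
  (\int[mu]_(t in `[0%R, X]) (t `^ (s - 1) * (t + 1) `^ (- nu))%:E <=
   (X `^ (s - h) / (s - h))%:E)%E.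
Proof.
move=> X0 h0 hs hnu.
rewrite -integral_itv_obnd_cbnd; last exact: measurable_integrand.
rewrite -integral_powR_0c ?subr_gt0//.
apply: ge0_le_integral => //.
- by move=> t _; rewrite lee_fin mulr_ge0 ?powR_ge0.
- exact: measurable_integrand.
- exact: measurable_powR_EFin.
move=> t /=; rewrite in_itv/= => /andP[t0 tX]; rewrite lee_fin.
have -> : s - h - 1 = (s - 1) - h by ring.
rewrite [leRHS]powRD ?(gt_eqF t0) ?implybT// ler_wpM2l ?powR_ge0//.
apply: (@le_trans _ _ ((t + 1) `^ (- h))).
  by apply: ler_powR; rewrite ?lerN2// lerDr ltW.
by apply: ler_npowR => //; rewrite lerDl.
Qed.

Lemma green_integral_le (s nu X h : R) : 0 < X -> 0 <= h -> h < s -> h <= nu ->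
  green_integral s nu X <= X `^ (s - h) / (s - h).
Proof.
move=> X0 h0 hs hnu; have le1 := integral_integrand_le _ _ _ _ X0 h0 hs hnu.
rewrite /green_integral/Rintegral -[leRHS]/(fine (_%:E)); apply: fine_le => //.
rewrite ge0_fin_numE; first exact: le_lt_trans le1 (ltry _).
by apply: integral_ge0 => t _; rewrite lee_fin mulr_ge0 ?powR_ge0.
Qed.

Lemma green_integral_ge (s nu X : R) : 0 < X -> 0 < s -> 0 <= nu ->
  X `^ s / s * (1 + X) `^ (- nu) <= green_integral s nu X.
Proof.
(* The upper bound with [h = 0] serves only to show that the integral is finite, so that [fine] is
   monotone here. *)
move=> X0 s0 nu0; have le1 := integral_integrand_le _ _ _ _ X0 (lexx 0) s0 nu0.
rewrite /green_integral/Rintegral -[leLHS]/(fine (_%:E)); apply: fine_le => //.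
  rewrite ge0_fin_numE; first exact: le_lt_trans le1 (ltry _).
  by apply: integral_ge0 => t _; rewrite lee_fin mulr_ge0 ?powR_ge0.
rewrite -integral_itv_obnd_cbnd; last exact: measurable_integrand.
rewrite mulrC EFinM -integral_powR_0c// -ge0_integralZl//; last 3 first.
- exact: measurable_powR_EFin.
- by move=> t _; rewrite lee_fin powR_ge0.
- by rewrite lee_fin powR_ge0.
apply: ge0_le_integral => //.
- by move=> t _; rewrite -EFinM lee_fin mulr_ge0 ?powR_ge0.
- by apply: measurable_funeM; exact: measurable_powR_EFin.
- exact: measurable_integrand.
move=> t /=; rewrite in_itv/= => /andP[t0 tX]; rewrite -EFinM lee_fin mulrC.
rewrite ler_wpM2l ?powR_ge0//; apply: ler_npowR => //; first by rewrite addr_gt0.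
by rewrite addrC lerD2l.
Qed.

End green_integral.

(** * Two-sided bounds for the rescaled Green kernel *)

Section green_estimate.
Context {R : realType}.

(** The rescaled Green kernel divided by [kappa], where [x] is the first coordinate of the point and
    [rm] its distance to the pole e e_1. *)
Definition green_profile (n : nat) (s e x rm : R) : R :=
  e `^ (- s) * (2^-1 * rm `^ (2 * s - n%:R) *
    green_integral s (n%:R / 2) (4 * x * e / rm ^+ 2)).

Let powR_ratio (p e x rm : R) : 0 < e -> 0 < x -> 0 < rm ->
  (4 * x * e / rm ^+ 2) `^ p = 4 `^ p * x `^ p * e `^ p * rm `^ (- (2 * p)).
Proof.
move=> e0 x0 rm0.
rewrite powRM ?mulr_ge0 ?invr_ge0 ?sqr_ge0 ?ltW//.
rewrite powRM ?mulr_ge0 ?ltW// powRM ?ltW//; congr (_ * _).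
by rewrite -powR_invn ?ltW// -powRrM mulNr.
Qed.

(** For [h = 0] this is the upper half of the squeeze, with no power of [e]; a positive [h] weakens
    the singularity in [rm] at the price of [e^(-h)]. *)
Lemma green_profile_le (n : nat) (s e x rm h : R) : 0 < e -> 0 < x -> 0 < rm ->
  0 <= h -> h < s -> h <= n%:R / 2 ->
  green_profile n s e x rm <=
  4 `^ (s - h) / (2 * (s - h)) * (x `^ (s - h) * e `^ (- h) * rm `^ (- (n%:R - 2 * h))).
Proof.
move=> e0 x0 rm0 h0 hs hn; have sh : s - h != 0 by rewrite gt_eqF// subr_gt0.
have X0 : 0 < 4 * x * e / rm ^+ 2 by rewrite divr_gt0 ?mulr_gt0// exprn_gt0.
have := green_integral_le s (n%:R / 2) _ h X0 h0 hs hn; rewrite powR_ratio// => H.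
rewrite /green_profile; apply: (le_trans (ler_wpM2l (powR_ge0 _ _) (ler_wpM2l _ H))).
  by rewrite mulr_ge0 ?powR_ge0.
have eE : e `^ (- h) = e `^ (- s) * e `^ (s - h).
  by rewrite -powRD ?(gt_eqF e0) ?implybT//; congr (_ `^ _); ring.
have rmE : rm `^ (- (n%:R - 2 * h)) = rm `^ (2 * s - n%:R) * rm `^ (- (2 * (s - h))).
  by rewrite -powRD ?(gt_eqF rm0) ?implybT//; congr (_ `^ _); ring.
rewrite eE rmE.
by rewrite le_eqVlt; apply/orP; left; apply/eqP; field.
Qed.

(** Since [rp^2 = rm^2 (1 + X)], the factor [(1 + X)^(-n/2)] turns [rm^(-n)] into [rp^(-n)]. *)
Lemma green_profile_ge (n : nat) (s e x rm rp : R) : 0 < s -> 0 < e -> 0 < x -> 0 < rm ->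
  0 < rp -> rp ^+ 2 = rm ^+ 2 + 4 * x * e ->
  4 `^ s / (2 * s) * (x `^ s * rp `^ (- n%:R)) <= green_profile n s e x rm.
Proof.
move=> s0 e0 x0 rm0 rp0 rpE.
have X0 : 0 < 4 * x * e / rm ^+ 2 by rewrite divr_gt0 ?mulr_gt0// exprn_gt0.
have := green_integral_ge s (n%:R / 2) _ X0 s0 (divr_ge0 (ler0n _ n) (ler0n _ 2)).
rewrite powR_ratio// => H.
rewrite /green_profile; apply: (le_trans _ (ler_wpM2l (powR_ge0 _ _) (ler_wpM2l _ H))); last first.
  by rewrite mulr_ge0 ?powR_ge0.
have rpN : rp `^ (- n%:R) = rm `^ (- n%:R) * (1 + 4 * x * e / rm ^+ 2) `^ (- (n%:R / 2)).
  have E (y : R) : 0 < y -> y `^ (- n%:R) = (y ^+ 2) `^ (- (n%:R / 2)).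
    by move=> y0; rewrite -powR_mulrn ?ltW// -powRrM; congr (_ `^ _); lra.
  rewrite !E// -powRM ?sqr_ge0//; last by rewrite ltW// addr_gt0.
  by congr (_ `^ _); rewrite rpE; field; rewrite gt_eqF.
have e1 : e `^ (- s) * e `^ s = 1.
  by rewrite -powRD ?(gt_eqF e0) ?implybT// addNr powRr0.
have rm1 : rm `^ (- n%:R) = rm `^ (2 * s - n%:R) * rm `^ (- (2 * s)).
  by rewrite -powRD ?(gt_eqF rm0) ?implybT//; congr (_ `^ _); ring.
rewrite rpN rm1 -[in leLHS](mul1r (4 `^ s / _)) -e1.
by rewrite le_eqVlt; apply/orP; left; apply/eqP; field; rewrite !gt_eqF ?powR_gt0.
Qed.

(** From below, [green_profile_ge] reduces to the Poisson difference. From above, if [rm < e / 2]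
    the profile alone is small enough; otherwise [e] and [x] are controlled by [rm], and [rm^(-n)]
    is compared with [r^(-n)]. *)
Lemma green_diff (n : nat) (s : R) : 0 < s < 1 -> 2 * s < n%:R ->
  exists2 C : R, 0 <= C & forall e x r rm : R,
  0 < e -> 0 < x <= r -> 0 < rm -> rm ^+ 2 = r ^+ 2 - 2 * e * x + e ^+ 2 ->
  `|green_profile n s e x rm - 4 `^ s / (2 * s) * (x `^ s * r `^ (- n%:R))| <=
  C * e `^ (s / 2) * (r `^ (- (n%:R - s / 2)) + rm `^ (- (n%:R - s / 2))).
Proof.
move=> /andP[s0 s1] sn.
have n1 : 1 <= n%:R :> R.
  by case: n sn => [|n] sn; [lra|rewrite ler1n].
have [k kE] : {k : R | k = 4 `^ s / (2 * s)} by exists (4 `^ s / (2 * s)).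
(* [C1] serves the lower bound and the region away from the pole, its 3 coming from [x^s <= 3 rm^s]
   there; [C2] serves the region [rm < e / 2]. *)
pose C1 : R := k * (3 * n%:R).
pose C2 : R := 4 `^ (s - s / 4) / (2 * (s - s / 4)) * 2 `^ (s - s / 4).
have k0 : 0 <= k by rewrite kE divr_ge0 ?powR_ge0// mulr_ge0// ltW.
have C10 : 0 <= C1 by rewrite mulr_ge0// mulr_ge0.
have C20 : 0 <= C2.
  by rewrite /C2 mulr_ge0 ?powR_ge0// divr_ge0 ?powR_ge0//; lra.
exists (C1 + C2); first exact: addr_ge0.
move=> e x r rm e0 /andP[x0 xr] rm0 rmE.
have r0 : 0 < r := lt_le_trans x0 xr.
have ex0 : 0 < e * x by rewrite mulr_gt0.
have exr : e * x <= e * r by rewrite ler_wpM2l// ltW.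
have xrm : (x - e) ^+ 2 <= rm ^+ 2.
  have : x ^+ 2 <= r ^+ 2 by rewrite ler_pXn2r ?nnegrE// ltW.
  by rewrite rmE sqrrB; lra.
have xe : `|x - e| <= rm.
  by rewrite -(@ler_pXn2r _ 2) ?nnegrE ?(ltW rm0)// real_normK ?num_real.
have rrm : r <= rm + e.
  have [rle|elr] := leP r e; first by lra.
  rewrite -lerBlDr -(@ler_pXn2r _ 2) ?nnegrE ?(ltW rm0) ?subr_ge0 ?(ltW elr)//.
  by rewrite rmE sqrrB; lra.
pose rp := Num.sqrt (r ^+ 2 + 2 * e * x + e ^+ 2).
have e20 : 0 < e ^+ 2 by rewrite exprn_gt0.
have r20 : 0 < r ^+ 2 by rewrite exprn_gt0.
have rp20 : 0 < r ^+ 2 + 2 * e * x + e ^+ 2 by lra.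
have rp0 : 0 < rp by rewrite sqrtr_gt0.
have rpE : rp ^+ 2 = r ^+ 2 + 2 * e * x + e ^+ 2 by rewrite sqr_sqrtr// ltW.
have rprm : rp ^+ 2 = rm ^+ 2 + 4 * x * e by rewrite rpE rmE; lra.
set a := n%:R - s / 2.
have ea0 : 0 <= e `^ (s / 2) by exact: powR_ge0.
have rma0 : 0 <= rm `^ (- a) by exact: powR_ge0.
have ra0 : 0 <= r `^ (- a) by exact: powR_ge0.
have T10 : 0 <= C1 * e `^ (s / 2) * r `^ (- a) by rewrite mulr_ge0// mulr_ge0.
have T20 : 0 <= C1 * e `^ (s / 2) * rm `^ (- a) by rewrite mulr_ge0// mulr_ge0.
have T30 : 0 <= C2 * e `^ (s / 2) * r `^ (- a) by rewrite mulr_ge0// mulr_ge0.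
have T40 : 0 <= C2 * e `^ (s / 2) * rm `^ (- a) by rewrite mulr_ge0// mulr_ge0.
rewrite -kE ler_norml; apply/andP; split.
  have Hge := green_profile_ge n s e x rm rp s0 e0 x0 rm0 rp0 rprm.
  have /andP[_ Hp] : 0 <= x `^ s * r `^ (- n%:R) - x `^ s * rp `^ (- n%:R) <=
    n%:R * e `^ (s / 2) * r `^ (- a).
    by apply: poisson_diff => //; [rewrite s0 | rewrite x0].
  have := ler_wpM2l k0 Hp.
  have : k * (n%:R * e `^ (s / 2) * r `^ (- a)) <= C1 * e `^ (s / 2) * r `^ (- a).
    rewrite /C1 -!mulrA ler_wpM2l// ler_peMl ?mulr_ge0//; lra.
  by rewrite -kE in Hge; lra.
(* Near the pole [x = e e_1] the bound by [rm `^ (- n)] is not integrable, and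
   the exponent [h = s / 4] is used instead of [h = 0]. *)
have [rme|erm] := ltP rm (e / 2).
  have s4 : 0 <= s / 4 by lra.
  have s4s : s / 4 < s by lra.
  have s4n : s / 4 <= n%:R / 2 by lra.
  have H := green_profile_le n s e x rm (s / 4) e0 x0 rm0 s4 s4s s4n.
  have aE : n%:R - 2 * (s / 4) = a by rewrite /a; lra.
  rewrite aE in H.
  (* Here [x - e <= rm < e / 2], so [x] is at most a multiple of [e] and [x^(3s/4) e^(-s/4)] is at
     most a multiple of [e^(s/2)]. *)
  have x2e : x <= 2 * e by move: xe; rewrite ler_norml => /andP[_]; lra.
  have xse : x `^ (s - s / 4) * e `^ (- (s / 4)) <= 2 `^ (s - s / 4) * e `^ (s / 2).
    have -> : e `^ (s / 2) = e `^ (s - s / 4) * e `^ (- (s / 4)).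
      by rewrite -powRD ?(gt_eqF e0) ?implybT//; congr (_ `^ _); lra.
    rewrite mulrA ler_wpM2r ?powR_ge0// -powRM ?(ltW e0)//.
    by apply: (@ge0_ler_powR _ (s - s / 4)); rewrite ?nnegrE ?mulr_ge0 ?(ltW x0) ?(ltW e0)//; lra.
  have {}H : green_profile n s e x rm <= C2 * e `^ (s / 2) * rm `^ (- a).
    apply: (le_trans H); rewrite /C2 -!mulrA ler_wpM2l ?powR_ge0//.
    rewrite ler_wpM2l ?invr_ge0//; first by lra.
    by rewrite mulrA [leRHS]mulrA ler_wpM2r.
  have : 0 <= k * (x `^ s * r `^ (- n%:R)) by rewrite mulr_ge0// mulr_ge0 ?powR_ge0.
  by lra.
have H := green_profile_le n s e x rm 0 e0 x0 rm0 (lexx 0) s0 (divr_ge0 (ler0n _ n) (ler0n _ 2)).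
rewrite mulr0 !subr0 oppr0 powRr0 mulr1 -kE in H.
suff : x `^ s * rm `^ (- n%:R) - x `^ s * r `^ (- n%:R) <= 3 * n%:R * e `^ (s / 2) * rm `^ (- a).
  by move=> /(ler_wpM2l k0); rewrite /C1 in T10 T20 *; lra.
have U0 : 0 <= 3 * n%:R * e `^ (s / 2) * rm `^ (- a) by rewrite !mulr_ge0.
have [rrm'|rmr] := leP r rm.
  apply: le_trans U0; rewrite -mulrBr; apply: mulr_ge0_le0; first exact: powR_ge0.
  by rewrite subr_le0 ler_npowR.
rewrite -mulrBr.
(* [x <= r <= rm + e] and [e <= 2 rm] away from the pole; moreover [3^s <= 3]. *)
have x3 : x `^ s <= 3 * rm `^ s.
  apply: (@le_trans _ _ ((3 * rm) `^ s)).
    by apply: (@ge0_ler_powR _ s); rewrite ?nnegrE ?mulr_ge0 ?(ltW x0) ?(ltW rm0) ?(ltW s0)//; lra.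
  rewrite powRM ?(ltW rm0)// ler_wpM2r ?powR_ge0//.
  by apply: ler1_powR; [rewrite ler1n|exact: ltW].
apply: (@le_trans _ _ (3 * rm `^ s * (n%:R * e `^ (s / 2) * rm `^ (- (n%:R + s / 2))))).
  apply: ler_pM => //; first exact: powR_ge0.
    by rewrite subr_ge0 ler_npowR// ltW.
  by apply: powRN_diff => //; [exact: ltW|lra].
have -> : rm `^ (- a) = rm `^ s * rm `^ (- (n%:R + s / 2)).
  by rewrite -powRD ?(gt_eqF rm0) ?implybT//; congr (_ `^ _); rewrite /a; lra.
by rewrite le_eqVlt; apply/orP; left; apply/eqP; ring.
Qed.

End green_estimate.

(** * Convergence from a pointwise bound *)

Section euclidean_norm.
Context {R : realType} {n : nat}.
Implicit Type x : 'rV[R]_n.+1.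

Lemma enorm_ge0 x : 0 <= enorm R n.+1 x.
Proof. exact: sqrtr_ge0. Qed.

Lemma sqr_enorm x : enorm R n.+1 x ^+ 2 = \sum_(i < n.+1) x ord0 i ^+ 2.
Proof. by rewrite sqr_sqrtr// sumr_ge0// => i _; rewrite sqr_ge0. Qed.

Lemma coord_le_enorm x i : `|x ord0 i| <= enorm R n.+1 x.
Proof.
rewrite -(@ler_pXn2r _ 2) ?nnegrE ?enorm_ge0// real_normK ?num_real//.
rewrite sqr_enorm (bigD1 i)//= lerDl sumr_ge0// => j _; exact: sqr_ge0.
Qed.

Lemma coord_subZe1 x (c : R) i :
  (x - c *: e1 R n) ord0 i = x ord0 i - c * (i == ord0)%:R.
Proof. by rewrite !mxE. Qed.

Lemma sqr_enorm_subZe1 x (c : R) :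
  enorm R n.+1 (x - c *: e1 R n) ^+ 2 =
  enorm R n.+1 x ^+ 2 - 2 * c * coord1 R n x + c ^+ 2.
Proof.
rewrite !sqr_enorm !(bigD1 ord0 isT)/= coord_subZe1 eqxx mulr1 /coord1.
rewrite (eq_bigr (fun i => x ord0 i ^+ 2)); first by ring.
by move=> i /negbTE i0; rewrite coord_subZe1 i0 mulr0 subr0.
Qed.

Lemma coord1_Ze1 (c : R) : coord1 R n (c *: e1 R n) = c.
Proof. by rewrite /coord1 !mxE eqxx mulr1. Qed.

Lemma coord1_le_enorm x : coord1 R n x <= enorm R n.+1 x.
Proof. by apply: le_trans (coord_le_enorm x ord0); exact: ler_norm. Qed.

(** By [|x_i| <= |x|], each coordinate takes an equal share of the exponent. A zero coordinate would
    spoil the bound, since negative powers of 0 have the default value 0. *)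
Lemma enorm_powRN_le_prod x (a : R) : 0 <= a -> (forall i, x ord0 i != 0) ->
  enorm R n.+1 x `^ (- a) <= \prod_(i < n.+1) `|x ord0 i| `^ (- (a / n.+1%:R)).
Proof.
move=> a0 x0.
have -> : enorm R n.+1 x `^ (- a) =
    \prod_(i < n.+1) enorm R n.+1 x `^ (- (a / n.+1%:R)).
  rewrite prodr_const card_ord -powR_mulrn ?powR_ge0// -powRrM; congr (_ `^ _).
  by rewrite mulNr divfK// pnatr_eq0.
apply: ler_prod => i _; rewrite powR_ge0/=.
by apply: ler_npowR; rewrite ?divr_ge0 ?normr_gt0 ?coord_le_enorm.
Qed.

(** With [m = max(1, |x|)], the weight is at most [m^(-b)] and each [max(1, |x_i|) <= m]. *)
Lemma inv_weight_le_prod x (b : R) : 0 <= b ->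
  (1 + enorm R n.+1 x `^ b)^-1 <=
  \prod_(i < n.+1) (Num.max 1 `|x ord0 i|) `^ (- (b / n.+1%:R)).
Proof.
move=> b0; set m := Num.max 1 (enorm R n.+1 x).
have m1 : 1 <= m by rewrite le_max lexx.
have m0 : 0 < m := lt_le_trans ltr01 m1.
apply: (@le_trans _ _ (m `^ (- b))).
  rewrite powRN lef_pV2 ?posrE ?powR_gt0//; last first.
    by rewrite ltr_pwDl// powR_ge0.
  rewrite /m; have [r1|r1] := leP 1 (enorm R n.+1 x); first by rewrite lerDr.
  by rewrite powR1 lerDl powR_ge0.
have -> : m `^ (- b) = \prod_(i < n.+1) m `^ (- (b / n.+1%:R)).
  rewrite prodr_const card_ord -powR_mulrn ?powR_ge0// -powRrM; congr (_ `^ _).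
  by rewrite mulNr divfK// pnatr_eq0.
apply: ler_prod => i _; rewrite powR_ge0/=.
apply: ler_npowR; first by rewrite divr_ge0.
  by rewrite lt_max ltr01.
by rewrite ge_max m1 le_max coord_le_enorm orbT.
Qed.

End euclidean_norm.

(** * From a pointwise estimate to both modes of convergence *)

Section close_kernels.
Context {R : realType} {n : nat} {s : R} (s0 : 0 < s) (s1 : s < 1).
Local Notation a := (n.+1%:R - s / 2).

(** The estimate shared by the Green and Poisson kernels; the last hypothesis excludes the pole eps
    e_1. *)
Definition close_kernels (f : R -> 'rV[R]_n.+1 -> R) (g : 'rV[R]_n.+1 -> R) (C : R) :=
  forall (eps : R) (x : 'rV[R]_n.+1), 0 < eps -> 0 < coord1 R n x ->
  0 < enorm R n.+1 (x - eps *: e1 R n) ->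
  `|f eps x - g x| <= C * eps `^ (s / 2) *
    (enorm R n.+1 x `^ (- a) + enorm R n.+1 (x - eps *: e1 R n) `^ (- a)).

Let n1 : 1 <= n.+1%:R :> R. Proof. by rewrite ler1n. Qed.
Let a0 : 0 < a.
Proof. by rewrite subr_gt0; apply: lt_le_trans n1; move: s1; lra. Qed.

(** On a nonempty [K] the first coordinate has a positive minimum [d]; once [eps < d / 2], both
    norms are at least [d / 2] and the bound is [eps^(s/2)] times a constant. *)
Lemma close_kernels_unif f g (C : R) : 0 <= C -> close_kernels f g C ->
  cvg_unif_compact R n f g.
Proof.
move=> C0 fg K cK KU e e0.
have [K0|/set0P Kn0] := eqVneq K set0.
  by near=> eps => x; rewrite K0.
have [c Kc cmin] : exists2 c : 'rV[R]_n.+1, c \in K &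
    forall t, t \in K -> coord1 R n c <= coord1 R n t.
  apply: EVT_min_rV => //; apply: continuous_subspaceT => x.
  exact: coord_continuous.
set d := coord1 R n c in cmin.
have d0 : 0 < d by apply: KU; exact: set_mem.
pose M := C * (d `^ (- a) + (d / 2) `^ (- a)).
have small : \forall eps \near 0^'+, eps `^ (s / 2) * M < e.
  apply: (@cvgr_lt _ _ _ _ _ 0) => //.
  by rewrite -[X in _ --> X](mul0r M); apply: cvgMl; apply: powR_cvg0; rewrite divr_gt0.
near=> eps => x Kx.
have eps0 : 0 < eps by near: eps; exact: nbhs_right_gt.
have epsd : eps < d / 2 by near: eps; apply: nbhs_right_lt; rewrite divr_gt0.
have dx : d <= coord1 R n x by apply: cmin; exact: mem_set.
have x0 : 0 < coord1 R n x := lt_le_trans d0 dx.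
have dm : d / 2 <= enorm R n.+1 (x - eps *: e1 R n).
  apply: le_trans (coord1_le_enorm _).
  by rewrite /coord1 coord_subZe1 eqxx mulr1 -/(coord1 R n x); lra.
have d20 : 0 < d / 2 by rewrite divr_gt0.
apply: (le_lt_trans (fg _ _ eps0 x0 (lt_le_trans d20 dm))).
apply: (@le_lt_trans _ _ (eps `^ (s / 2) * M)); last by near: eps.
rewrite /M mulrA [C * _]mulrC ler_wpM2l ?mulr_ge0 ?powR_ge0// lerD//.
  by apply: ler_npowR => //; [exact: ltW|exact: le_trans dx (coord1_le_enorm _)].
by apply: ler_npowR => //; exact: ltW.
Unshelve. all: by end_near. Qed.

Lemma close_kernels_L1s f g (C : R) : 0 <= C -> close_kernels f g C ->
  cvg_L1s R n s f g.
Proof.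
move=> C0 fg.
(* Exponents per coordinate: [a < N] gives [al < 1], and the [2 s] in the weight gives [b > 1]. *)
pose al := a / n.+1%:R; pose b := (n.+1%:R + 2 * s) / n.+1%:R.
have al01 : 0 < al < 1.
  by rewrite divr_gt0//= ltr_pdivrMr// mul1r; move: s0; lra.
have b1 : 1 < b by rewrite ltr_pdivlMr// mul1r; move: s0; lra.
have [I I0 HI] := integral_singular_le al b al01 b1.
(* Only the first coordinate of x - eps e_1 is shifted; the sum of the singularities at 0 and [e]
   majorises every case with one function. *)
pose phi (e t : R) := `|t - 0| `^ (- al) * (Num.max 1 `|t|) `^ (- b) +
  `|t - e| `^ (- al) * (Num.max 1 `|t|) `^ (- b).
have phi0 e t : 0 <= phi e t by rewrite addr_ge0// mulr_ge0 ?powR_ge0.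
have mpsi (c : R) : measurable_fun setT (fun t : R => `|t - c| `^ (- al) * (Num.max 1 `|t|) `^ (- b)).
  apply: measurable_funM.
    apply: (measurableT_comp (measurable_powR _)) => //.
    by apply: measurableT_comp => //; exact: measurable_funB.
  apply: (measurableT_comp (measurable_powR _)) => //.
  apply: measurable_maxr => //.
have mphi e : measurable_fun setT (phi e) by exact: measurable_funD.
have iphi e : (\int[lebesgue_measure]_t (phi e t)%:E <= (I + I)%:E)%E.
  under eq_integral do rewrite EFinD.
  rewrite ge0_integralD//.
  - by rewrite EFinD; apply: leeD.
  - by apply/measurable_EFinP; exact: mpsi.
  - by apply/measurable_EFinP; exact: mpsi.
pose G (eps : R) (y : nat -> R) : \bar R :=
  let x := vec_of R n.+1 y in
  if 0 < coord1 R n x then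
    (`|f eps x - g x| / (1 + enorm R n.+1 x `^ (n.+1%:R + 2 * s)))%:E
  else 0%E.
have G0 eps y : (0 <= G eps y)%E.
  rewrite /G; case: ifP => // _; rewrite lee_fin divr_ge0// addr_ge0// powR_ge0//.
have bound eps : 0 < eps -> (L1s_dist R n s (f eps) g <=
    (2 * C * eps `^ (s / 2) * (I + I) ^+ n.+1)%:E)%E.
  (* Off the null set [[set 0; eps]] no coordinate of x or x - eps e_1 vanishes. *)
  move=> eps0; apply: (iter_int_le_prod _ _ (G eps) [set 0; eps] (phi eps)) => //.
  - exact: measurableU.
  - by rewrite measureU0//; exact: lebesgue_measure_set1.
  - exact: addr_ge0.
  - by rewrite !mulr_ge0 ?powR_ge0.
  move=> y nZy.
  have P0 : 0 <= \prod_(i < n.+1) phi eps (y i) by apply: prodr_ge0.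
  rewrite /G; set x := vec_of R n.+1 y; case: ifPn => x0; last first.
    by rewrite lee_fin mulr_ge0// !mulr_ge0 ?powR_ge0.
  have xE i : x ord0 i = y i by rewrite mxE.
  have y0 i : y (i : 'I_n.+1) != 0.
    by apply/eqP => yi; apply: (nZy i) => //; left.
  have ye i : y (i : 'I_n.+1) - eps != 0.
    by rewrite subr_eq0; apply/eqP => yi; apply: (nZy i) => //; right.
  have xe0 i : (x - eps *: e1 R n) ord0 i != 0.
    rewrite coord_subZe1 xE; case: (i =P ord0) => _; first by rewrite mulr1 ye.
    by rewrite mulr0 subr0 y0.
  have rm0 : 0 < enorm R n.+1 (x - eps *: e1 R n).
    by apply: lt_le_trans (coord_le_enorm _ ord0); rewrite normr_gt0.
  rewrite lee_fin; set w := (_ + _ `^ (_ + _)).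
  have w0 : 0 <= w^-1 by rewrite invr_ge0 addr_ge0// powR_ge0.
  apply: (le_trans (ler_wpM2r w0 (fg _ _ eps0 x0 rm0))).
  have Hw : w^-1 <= \prod_(i < n.+1) (Num.max 1 `|y i|) `^ (- b).
    have := inv_weight_le_prod x (n.+1%:R + 2 * s); rewrite -/b.
    under eq_bigr do rewrite xE.
    by apply; rewrite addr_ge0// mulr_ge0// ltW.
  have Hr : enorm R n.+1 x `^ (- a) * w^-1 <= \prod_(i < n.+1) phi eps (y i).
    apply: (@le_trans _ _ ((\prod_(i < n.+1) `|y i| `^ (- al)) *
        (\prod_(i < n.+1) (Num.max 1 `|y i|) `^ (- b)))).
      apply: ler_pM; rewrite ?powR_ge0//.
      have := enorm_powRN_le_prod x a (ltW a0); rewrite -/al.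
      under eq_bigr do rewrite xE.
      by apply => i; rewrite xE.
    rewrite -big_split/=; apply: ler_prod => i _.
    rewrite mulr_ge0 ?powR_ge0//= /phi subr0 lerDl.
    by rewrite mulr_ge0 ?powR_ge0.
  have Hm : enorm R n.+1 (x - eps *: e1 R n) `^ (- a) * w^-1 <=
      \prod_(i < n.+1) phi eps (y i).
    apply: (@le_trans _ _ ((\prod_(i < n.+1) `|(x - eps *: e1 R n) ord0 i| `^ (- al)) *
        (\prod_(i < n.+1) (Num.max 1 `|y i|) `^ (- b)))).
      apply: ler_pM; rewrite ?powR_ge0//.
      exact: (enorm_powRN_le_prod _ a (ltW a0)).
    rewrite -big_split/=; apply: ler_prod => i _.
    rewrite mulr_ge0 ?powR_ge0//= /phi coord_subZe1 xE.
    case: (i =P ord0) => _; first by rewrite mulr1 lerDr mulr_ge0 ?powR_ge0.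
    by rewrite mulr0 subr0 lerDl mulr_ge0 ?powR_ge0.
  rewrite -[leLHS]mulrA [X in _ * X <= _]mulrDl.
  apply: (le_trans (ler_wpM2l _ (lerD Hr Hm))).
    by rewrite mulr_ge0 ?powR_ge0.
  by rewrite le_eqVlt; apply/orP; left; apply/eqP; ring.
apply: (@squeeze_cvge _ _ _ _ (fun=> 0%E) _
  (fun eps => (2 * C * eps `^ (s / 2) * (I + I) ^+ n.+1)%:E)).
- near=> eps; apply/andP; split.
    by apply: iter_int_ge0 => y; exact: (G0 eps y).
  by apply: bound; near: eps; exact: nbhs_right_gt.
- exact: cvg_cst.
apply: cvg_EFin; first by near=> eps.
rewrite /comp/= [X in _ --> X](_ : _ = 2 * C * 0 * (I + I) ^+ n.+1); last by ring.
apply: cvgMl; apply: cvgMr; apply: powR_cvg0; by rewrite divr_gt0.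
Unshelve. all: by end_near. Qed.

End close_kernels.

(** * The two kernels of the half space *)

(** [eps^s (x_1 / eps)^s = x_1^s], so the rescaled kernel is [Kcst] times [x_1^s rp^(-N)] and
    [poisson_diff] applies. *)
Lemma poisson_close (R : realType) (n : nat) (s : R) : 0 < s -> s < 1 ->
  @close_kernels R n s
    (fun eps x => eps `^ s * poisson R n s x (- (eps *: e1 R n))) (Ps R n s)
    (`|Kcst R n.+1 s| * n.+1%:R).
Proof.
move=> s0 s1 eps x eps0 x0 rm0.
have r0 : 0 < enorm R n.+1 x := lt_le_trans x0 (coord1_le_enorm x).
have e2 := sqr_enorm_subZe1 x (- eps); rewrite /poisson -scaleNr coord1_Ze1 opprK.
set rp := enorm R n.+1 (x - - eps *: _) in e2 *.
have rpr : rp ^+ 2 = enorm R n.+1 x ^+ 2 + 2 * eps * coord1 R n x + eps ^+ 2.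
  by rewrite e2; ring.
have rp0 : 0 < rp.
  rewrite lt0r enorm_ge0 andbT; apply/eqP => rp0; move: rpr; rewrite rp0.
  have : 0 < eps * coord1 R n x by rewrite mulr_gt0.
  have : 0 < eps ^+ 2 by rewrite exprn_gt0.
  have : 0 < enorm R n.+1 x ^+ 2 by rewrite exprn_gt0.
  by rewrite expr0n/=; lra.
have /andP[d0 dle] : 0 <= coord1 R n x `^ s * enorm R n.+1 x `^ (- n.+1%:R) -
    coord1 R n x `^ s * rp `^ (- n.+1%:R) <=
    n.+1%:R * eps `^ (s / 2) * enorm R n.+1 x `^ (- (n.+1%:R - s / 2)).
  by apply: poisson_diff => //; rewrite ?s0 ?x0 ?coord1_le_enorm.
have -> : eps `^ s * (Kcst R n.+1 s * (coord1 R n x / eps) `^ s * rp `^ (- n.+1%:R)) -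
    Ps R n s x = - Kcst R n.+1 s *
    (coord1 R n x `^ s * enorm R n.+1 x `^ (- n.+1%:R) -
     coord1 R n x `^ s * rp `^ (- n.+1%:R)).
  rewrite /Ps.
  have -> : coord1 R n x `^ s = eps `^ s * (coord1 R n x / eps) `^ s.
    rewrite -powRM ?divr_ge0 ?(ltW eps0) ?(ltW x0)//.
    by congr (_ `^ _); field; rewrite gt_eqF.
  by ring.
rewrite normrM normrN (ger0_norm d0) -!mulrA ler_wpM2l//.
apply: (le_trans dle); rewrite -mulrA ler_wpM2l// ler_wpM2l ?powR_ge0//.
(* The term in x - eps e_1 is added only to match the shape shared with the Green kernel. *)
by rewrite lerDl powR_ge0.
Qed.

Lemma green_close (R : realType) (n : nat) (s : R) :
  0 < s -> s < 1 -> 2 * s < n.+1%:R ->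
  exists2 C, 0 <= C & @close_kernels R n s
    (fun eps x => eps `^ (- s) * green R n s x (eps *: e1 R n)) (Ps R n s) C.
Proof.
move=> s0 s1 sn.
have s01 : 0 < s < 1 by rewrite s0.
have [C C0 HC] := green_diff n.+1 s s01 sn.
exists (`|kappa R n.+1 s| * C); first by rewrite mulr_ge0.
move=> eps x eps0 x0 rm0.
have r0 : 0 < enorm R n.+1 x := lt_le_trans x0 (coord1_le_enorm x).
have e2 := sqr_enorm_subZe1 x eps; rewrite /green coord1_Ze1 x0 eps0/=.
rewrite -/(green_integral s (n.+1%:R / 2) _).
set rm := enorm R n.+1 (x - _) in rm0 e2 *.
have := HC eps (coord1 R n x) (enorm R n.+1 x) rm eps0 _ rm0 e2.
rewrite x0 coord1_le_enorm => /(_ isT) H.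
have -> : eps `^ (- s) * (kappa R n.+1 s / 2 * rm `^ (2 * s - n.+1%:R) *
    green_integral s (n.+1%:R / 2) (4 * coord1 R n x * eps / rm ^+ 2)) - Ps R n s x =
    kappa R n.+1 s * (green_profile n.+1 s eps (coord1 R n x) rm -
    4 `^ s / (2 * s) * (coord1 R n x `^ s * enorm R n.+1 x `^ (- n.+1%:R))).
  rewrite /Ps /Kcst /green_profile.
  (* This identifies [Kcst] with [kappa] times [4^s / (2 s)], the constant in both halves of the
     squeeze. *)
  have -> : 2 `^ (2 * s - 1) = 4 `^ s / 2 :> R.
    rewrite powRB ?pnatr_eq0 ?implybT// powRr1// powRrM; congr (_ `^ _ / _).
    by rewrite powR_mulrn// -natrX.
  by field; rewrite gt_eqF.
by rewrite normrM; apply: (le_trans (ler_wpM2l (normr_ge0 _) H)); rewrite !mulrA.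
Qed.

(* The space dimension N is written n.+1 (N >= 1 is forced by N > 2s > 0). *)
Theorem theorem1p3 (R : realType) (n : nat) (s : R)
    (hs0 : 0 < s) (hs1 : s < 1) (hN : 2 * s < n.+1%:R) :
  let Gf := fun eps : R => fun x : 'rV[R]_n.+1 =>
    eps `^ (- s) * green R n s x (eps *: e1 R n) in
  let Pf := fun eps : R => fun x : 'rV[R]_n.+1 =>
    eps `^ s * poisson R n s x (- (eps *: e1 R n)) in
  [/\ cvg_L1s R n s Gf (Ps R n s), cvg_unif_compact R n Gf (Ps R n s),
      cvg_L1s R n s Pf (Ps R n s) & cvg_unif_compact R n Pf (Ps R n s)].
Proof.
move=> Gf Pf.
have [C C0 closeG] := green_close R n s hs0 hs1 hN.
have closeP := poisson_close R n s hs0 hs1.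
have K0 : 0 <= `|Kcst R n.+1 s| * n.+1%:R by rewrite mulr_ge0.
split.
- exact: (close_kernels_L1s hs0 hs1 _ _ _ C0 closeG).
- exact: (close_kernels_unif hs0 hs1 _ _ _ C0 closeG).
- exact: (close_kernels_L1s hs0 hs1 _ _ _ K0 closeP).
- exact: (close_kernels_unif hs0 hs1 _ _ _ K0 closeP).
Qed.
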